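(* Every set $\mathcal{A}\subset\mathbb{R}$ of size $3$ has complexity $C(\mathcal{A})=2$.
   Context: For a finite set $\mathcal{A}\subset\mathbb{R}$, the complexity $C(\mathcal{A})$ is the smallest positive integer $\theta$ for which there exist (not necessarily distinct) real numbers $x_1,\dots,x_\theta,y_1,\dots,y_\theta$ with $\mathcal{A}\subseteq\{x_1,y_1\}+\{x_2,y_2\}+\cdots+\{x_\theta,y_\theta\}$, where $+$ denotes the sumset $\mathcal{S}+\mathcal{T}=\{s+t\mid s\in\mathcal{S},t\in\mathcal{T}\}$. *)

(* Defs.v *)
From mathcomp Require Import all_boot all_order all_algebra finmap.
From mathcomp Require Import boolp classical_sets reals.

Set Implicit Arguments.
Unset Strict Implicit.
Unset Printing Implicit Defensive.

Import GRing.Theory.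
Local Open Scope classical_set_scope.
Local Open Scope ring_scope.

Definition sumset (R : realType) (S T : set R) : set R :=
  [set s + t | s in S & t in T].

(* [set 0] is the neutral element of sumset, hence the right value for the
   empty iterated sumset. *)
Definition pairs_sumset (R : realType) (theta : nat) (x y : 'I_theta -> R) :
    set R :=
  \big[@sumset R/[set 0]]_(i < theta) [set x i; y i].

Definition covered_by_pairs (R : realType) (A : {fset R}) (theta : nat) :
    Prop :=
  exists x y : 'I_theta -> R, [set` A] `<=` pairs_sumset x y.

Lemma mem_pairs_sumset (R : realType) (theta : nat) (x y z : 'I_theta -> R) :
  (forall i, [set x i; y i] (z i)) ->
  pairs_sumset x y (\sum_(i < theta) z i).
Proof.
move=> zP; rewrite /pairs_sumset.
apply: (big_ind2 (fun (s : R) (S : set R) => S s)) => [//|s S t T Ss Tt|i _].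
- by exists s => //; exists t.
- exact: zP.
Qed.

(* If A = {a_1, ..., a_n}, then A is contained in {0, a_1} + ... + {0, a_n};
   the additional summand {0, 0} accounts for the empty set. *)
Lemma covered_by_pairs_ex (R : realType) (A : {fset R}) :
  exists theta : nat, (0 < theta)%N && `[< covered_by_pairs A theta >].
Proof.
exists (size (enum_fset A)).+1 => /=; apply/asboolP.
pose y (i : 'I_(size (enum_fset A)).+1) := (enum_fset A)`_i.
exists (fun=> 0), y => a /= aA.
have iA : (index a (enum_fset A) < (size (enum_fset A)).+1)%N.
  by rewrite ltnS index_size.
pose i0 := Ordinal iA.
have -> : a = \sum_i (if i == i0 then y i else 0).
  by rewrite -big_mkcond big_pred1_eq /y /= nth_index.
by apply: mem_pairs_sumset => i; case: ifP => _; [right | left].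
Qed.

Definition complexity (R : realType) (A : {fset R}) : nat :=
  ex_minn (covered_by_pairs_ex A).

(* Main.v *)
Require Import Defs.
From mathcomp Require Import all_boot all_order all_algebra finmap.
From mathcomp Require Import boolp classical_sets reals.

Import GRing.Theory.

(** A single summand {x, y} has at most two elements, so it cannot contain three reals
    ([covered_by_pairs1_card]). Two summands suffice by an explicit cover that does not depend on
    how the three reals are spaced ([covered_by_pairs2]). *)

Lemma covered_by_pairs1_card (R : realType) (A : {fset R}) :
  covered_by_pairs A 1 -> #|` A| <= 2.
Proof.
move=> [x [y Axy]].
apply: (@uniq_leq_size _ _ [:: x ord0; y ord0]) => [|a aA].
  exact: fset_uniq.
(* The iterated sumset ends in the neutral {0}, so it unfolds here to {x, y} + {0}. *)
have := Axy a aA; rewrite /pairs_sumset big_ord_recl big_ord0.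
by move=> [s [->|->] [_ -> <-]]; rewrite addr0 !inE eqxx ?orbT.
Qed.

(* If A = {a, b, c}, then A is contained in {a, b} + {0, c - a}. *)
Lemma covered_by_pairs2 (R : realType) (A : {fset R}) :
  #|` A| = 3 -> covered_by_pairs A 2.
Proof.
case def_A: (enum_fset A) => [|a [|b [|c []]]] // _.
(* [pair] builds both the endpoint families and, in [mem2], the choice of one element per
   summand. *)
pose pair (u v : R) (i : 'I_2) := if i == ord0 then u else v.
exists (pair a 0%R), (pair b (c - a)%R) => d /= dA.
have mem2 (u v : R) : (u = a \/ u = b) -> (v = 0 \/ v = c - a)%R ->
    pairs_sumset (pair a 0%R) (pair b (c - a)%R) (u + v)%R.
  move=> uP vP; have -> : (u + v = \sum_(i < 2) pair u v i)%R.
    by rewrite big_ord_recl big_ord1.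
  by apply: mem_pairs_sumset => i; rewrite /pair; case: ifP.
have : d \in [:: a; b; c] by rewrite -def_A.
rewrite !inE => /or3P[] /eqP->.
- by rewrite -[a in X in _ X]addr0; apply: mem2; left.
- by rewrite -[b in X in _ X]addr0; apply: mem2; [right | left].
- by rewrite -[c in X in _ X](subrKC a); apply: mem2; [left | right].
Qed.

Theorem proposition3 (R : realType) (A : {fset R}) (hA : #|` A| = 3) :
  complexity A = 2.
Proof.
rewrite /complexity; case: ex_minnP => theta /andP[theta_gt0 /asboolP covA] min.
have theta_le2 : theta <= 2.
  by apply: min; apply/asboolP; exact: covered_by_pairs2.
(* Only [theta = 1] is left to exclude. *)
case: theta theta_gt0 theta_le2 covA {min} => [|[|[|]]] // _ _.
by move/covered_by_pairs1_card; rewrite hA.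
Qed.
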